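(* Let $\mathbb{P}$ be the forcing poset consisting of triples $(T,F,A)$ satisfying: (1) $T=(|T|,<_T)$ is a finite tree on $\omega_1$; (2) $F$ is an injective function from the set of maximal nodes of $T$ into $\omega_2$; (3) $A$ is a finite adequate set; (4) if $M\in A$, $a$ and $b$ are distinct maximal nodes of $T$, and $F(a),F(b)\in M$, then every $c$ which is below both $a$ and $b$ in $T$ is in $M$; ordered by $(U,G,B)\le(T,F,A)$ iff $U$ end-extends $T$, $A\subseteq B$, and whenever $a$ is maximal in $T$ there is $b$ maximal in $U$ such that $a\le_U b$ and $F(a)=G(b)$. Let $\dot R$ be a $\mathbb{P}$-name for the set of pairs $(\alpha,\beta)$ for which there is $(T,F,A)\in\dot G$ (the generic filter) with $\alpha<_T\beta$, and let $\dot T$ be a $\mathbb{P}$-name for the tree $(\omega_1,\dot R)$. Then $\mathbb{P}$ forces that $\dot T$ has $\omega_2$ many distinct branches.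
   Context: Standing assumptions and notation. Assume $2^{\omega_1}=\omega_2$ and fix a bijection $\pi:\omega_2\to H(\omega_2)$. $P_{\omega_1}(\omega_2)$ is the set of countable subsets of $\omega_2$. Assume there is a stationary set $\mathcal{Y}\subseteq P_{\omega_1}(\omega_2)$ which is thin, i.e. for all $\beta<\omega_2$ the set $\{a\cap\beta: a\in\mathcal{Y}\}$ has size at most $\omega_1$; fix such a $\mathcal{Y}$ which is moreover closed under initial segments ($a\in\mathcal{Y}$, $\beta<\omega_2$ imply $a\cap\beta\in\mathcal{Y}$). Let $\mathcal{A}$ be the structure $(H(\omega_2),\in,\pi,\mathcal{Y})$, which has definable Skolem functions (via the well-ordering induced by $\pi$). For $a\subseteq H(\omega_2)$, $Sk(a)$ is the closure of $a$ under a fixed set of definable Skolem functions for $\mathcal{A}$. Let $C$ be the (club) set of $\beta<\omega_2$ with $Sk(\beta)\cap\omega_2=\beta$, and let $\Lambda$ be the set of $\beta<\omega_2$ of cofinality $\omega_1$ which are limit points of $C$. Let $\mathcal{X}$ be the set of $M\in\mathcal{Y}$ such that $Sk(M)\cap\omega_2=M$ and for all $\gamma\in M$, $\sup(C\cap\gamma)\in M$. Comparison points and adequacy. Fix a set $\Gamma\subseteq\Lambda$ which is stationary in $\omega_2$. For $M\in\mathcal{X}$, $\Gamma_M$ is the set of $\beta\in\Gamma$ such that $\beta=\min(\Gamma\setminus\sup(M\cap\beta))$, i.e. $\Gamma\cap[\sup(M\cap\beta),\beta)=\emptyset$. For $M,N\in\mathcal{X}$, $\Gamma_M\cap\Gamma_N$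 has a largest element, denoted $\beta_{M,N}$. A set $A\subseteq\mathcal{X}$ is adequate if for all $M,N\in A$, either $M\cap\beta_{M,N}=N\cap\beta_{M,N}$, or $M\cap\beta_{M,N}\in Sk(N)$, or $N\cap\beta_{M,N}\in Sk(M)$. Finite trees. A finite tree on $\omega_1$ is a pair $T=(|T|,<_T)$ such that $|T|$ is a finite subset of $\omega_1$; $<_T$ is an irreflexive transitive relation on $|T|$; if $a,b<_T c$ then $a=b$, $a<_T b$ or $b<_T a$; and $a<_T b$ implies $a<b$. $U$ end-extends $T$ if $|T|\subseteq|U|$ and $<_U\cap(|T|\times|T|)=\ <_T$. $\mathbb{P}$ preserves $\omega_1$ and $\omega_2$. *)

(* Defs.v *)
(* The ground model is Rocq's own universe of types with classical logic and
   choice.  Ordinals below omega_2 are the points of a well-ordered type W of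
   order type omega_2; subsets of omega_2 are MathComp-Analysis sets over W. *)
From mathcomp Require Import all_boot all_order.
From mathcomp Require Import boolp classical_sets functions cardinality.
From Stdlib Require Import Relation_Operators.

Set Implicit Arguments.
Unset Strict Implicit.
Unset Printing Implicit Defensive.

Local Open Scope order_scope.
Local Open Scope classical_set_scope.
Local Open Scope card_scope.

(* Iterative (Aczel) sets, with extensional equality [V_eq]. *)
Inductive V : Type := VSup (A : Type) (f : A -> V).

Fixpoint V_eq (x y : V) : Prop :=
  match x, y with
  | VSup A f, VSup B g =>
      (forall i, exists j, V_eq (f i) (g j)) /\
      (forall j, exists i, V_eq (f i) (g j))
  end.

Definition V_mem (x y : V) : Prop :=
  let: VSup A g := y in exists j, V_eq x (g j).

(* The quotient of [V] by [V_eq], as the type of equivalence classes: on it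
   Leibniz equality is equality of sets. *)
Definition zset : Type := {c : V -> Prop | exists x, c = V_eq x}.

Definition zclass (x : V) : zset := exist _ (V_eq x) (ex_intro _ x erefl).

Definition zmem (x y : zset) : Prop :=
  exists u v, [/\ sval x u, sval y v & V_mem u v].

Definition trcl (x : zset) : zset -> Prop := fun y => clos_trans zset zmem y x.

(* [w1] is omega_1: the least point with uncountably many predecessors.
   W has size greater than omega_1, its proper initial segments do not. *)
Record omega2Type (d : Order.disp_t) : Type := Omega2Type {
  omega2_order :> orderType d;
  omega2_wf : well_founded (fun a b : omega2_order => a < b);
  w1 : omega2_order;
  w1_uncountable : ~ countable [set a : omega2_order | a < w1];
  w1_least : forall b : omega2_order,
    b < w1 -> countable [set a : omega2_order | a < b];
  omega2_big : ~ ([set: omega2_order] #<= [set a : omega2_order | a < w1]);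
  omega2_least : forall b : omega2_order,
    [set a : omega2_order | a < b] #<= [set a : omega2_order | a < w1]
}.

Arguments w1 {d W} : rename.

Section Ordinals.
Context {d : Order.disp_t} {W : omega2Type d}.
Implicit Types (a b g : W) (A M : set W).

(* An ordinal is identified with the set of its predecessors. *)
Definition seg b : set W := [set a | a < b].

(* sup(A), with sup(set0) = 0; only used on bounded A. *)
Definition osup A : W := xget w1 (supremums A).

Definition limit_point A b : Prop :=
  (exists a, a < b) /\ forall a, a < b -> exists g, [/\ A g, a < g & g < b].

Definition cofinal_in A b : Prop :=
  A `<=` seg b /\ forall a, a < b -> exists2 g, A g & a <= g.

(* omega_1 is the least cardinality of a cofinal subset of b. *)
Definition cof_omega1 b : Prop :=
  (exists2 A, cofinal_in A b & A #= seg w1) /\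
  forall A, cofinal_in A b -> seg w1 #<= A.

Definition club (K : set W) : Prop :=
  (forall a, exists2 b, K b & a < b) /\ (forall b, limit_point K b -> K b).

Definition stationary A : Prop := forall K, club K -> A `&` K !=set0.

Definition club_countable (K : set (set W)) : Prop :=
  [/\ forall M, K M -> countable M,
      forall M, countable M -> exists2 N, K N & M `<=` N
    & forall c : nat -> set W, (forall n, K (c n)) ->
        (forall n, c n `<=` c n.+1) -> K (\bigcup_n c n)].

Definition stationary_countable (Y : set (set W)) : Prop :=
  (forall M, Y M -> countable M) /\
  forall K, club_countable K -> Y `&` K !=set0.

Definition thin (Y : set (set W)) : Prop :=
  forall b, [set M `&` seg b | M in Y] #<= seg w1.

Definition segment_closed (Y : set (set W)) : Prop :=
  forall M b, Y M -> Y (M `&` seg b).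

Definition vord : W -> V :=
  Fix (@omega2_wf d W) (fun _ => V)
    (fun b rec => VSup (fun a : {a : W | a < b} => rec (sval a) (svalP a))).

Definition vset_of A : V := VSup (fun a : {a : W | A a} => vord (sval a)).

Definition zord a : zset := zclass (vord a).

Definition zset_of A : zset := zclass (vset_of A).

End Ordinals.

(* H(omega_2): the sets whose transitive closure has size less than omega_2.
   Collections of [zset]s are plain predicates: [zset] lives in too large a
   universe for [set] and [#<=] to apply to it. *)
Definition HC {d : Order.disp_t} (W : omega2Type d) : zset -> Prop :=
  fun x => ~ exists2 h : W -> zset, injective h & forall a, trcl x (h a).

Definition bijection_HC {d : Order.disp_t} {W : omega2Type d}
    (pi : W -> zset) : Prop :=
  injective pi /\ forall x, HC W x <-> exists a, pi a = x.

(* First-order formulas with n free variables; [FEx] binds variable 0. *)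
Inductive formula : nat -> Type :=
  | FEq n (i j : 'I_n) : formula n
  | FMem n (i j : 'I_n) : formula n
  | FPi n (i j : 'I_n) : formula n
  | FY n (i : 'I_n) : formula n
  | FNot n : formula n -> formula n
  | FAnd n : formula n -> formula n -> formula n
  | FEx n : formula n.+1 -> formula n.

Definition scons (T : Type) n (y : T) (e : 'I_n -> T) (i : 'I_n.+1) : T :=
  if unlift ord0 i is Some j then e j else y.

Section Models.
Context {d : Order.disp_t} {W : omega2Type d}.
Variables (pi : W -> zset) (Y : set (set W)) (Gamma : set W).
Implicit Types (a b g : W) (M N : set W).

Fixpoint sat n (phi : formula n) : ('I_n -> zset) -> Prop :=
  match phi in formula n return ('I_n -> zset) -> Prop with
  | FEq _ i j => fun e => e i = e j
  | FMem _ i j => fun e => zmem (e i) (e j)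
  | FPi _ i j => fun e => exists2 a, e i = zord a & e j = pi a
  | FY _ i => fun e => exists2 M, Y M & e i = zset_of M
  | FNot _ phi => fun e => ~ sat phi e
  | FAnd _ phi psi => fun e => sat phi e /\ sat psi e
  | FEx _ phi => fun e => exists2 y, HC W y & sat phi (scons y e)
  end.

(* the well-ordering of H(omega_2) induced by pi *)
Definition pi_lt (x y : zset) : Prop :=
  exists a b, [/\ x = pi a, y = pi b & a < b].

(* The Skolem function of phi sends e to the pi-least witness y of
   phi(y, e), and is undefined when there is no witness. *)
Definition skolem n (phi : formula n.+1) (e : 'I_n -> zset) (y : zset) : Prop :=
  [/\ HC W y, sat phi (scons y e)
    & forall z, HC W z -> sat phi (scons z e) -> ~ pi_lt z y].

Inductive Sk_closure (X : zset -> Prop) : zset -> Prop :=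
  | Sk_base x : X x -> Sk_closure X x
  | Sk_step n (phi : formula n.+1) (e : 'I_n -> zset) y :
      (forall i, Sk_closure X (e i)) -> skolem phi e y -> Sk_closure X y.

Definition Sk M : zset -> Prop :=
  Sk_closure (fun x => exists2 a, M a & x = zord a).

(* Sk(M) \cap omega_2 *)
Definition Sk_trace M : set W := [set a | Sk M (zord a)].

Definition Cset : set W := [set b | Sk_trace (seg b) = seg b].

Definition Lambda : set W := [set b | cof_omega1 b /\ limit_point Cset b].

Definition Xset : set (set W) :=
  [set M | [/\ Y M, Sk_trace M = M
             & forall g, M g -> M (osup (Cset `&` seg g))]].

Definition Gamma_of M : set W :=
  [set b | Gamma b /\
     Gamma `&` [set g | osup (M `&` seg b) <= g /\ g < b] = set0].

(* beta_{M,N}: the largest element of Gamma_M \cap Gamma_N *)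
Definition beta M N : W :=
  xget w1 [set b | (Gamma_of M `&` Gamma_of N) b /\
                   ubound (Gamma_of M `&` Gamma_of N) b].

Definition adequate (A : set (set W)) : Prop :=
  A `<=` Xset /\
  forall M N, A M -> A N ->
    [\/ M `&` seg (beta M N) = N `&` seg (beta M N),
        Sk N (zset_of (M `&` seg (beta M N)))
      | Sk M (zset_of (N `&` seg (beta M N)))].

Record finite_tree : Type := FiniteTree {
  nodes : set W;
  tlt : W -> W -> Prop;
  nodes_finite : finite_set nodes;
  nodes_w1 : nodes `<=` seg w1;
  tlt_nodes : forall a b, tlt a b -> nodes a /\ nodes b;
  tlt_irr : forall a, ~ tlt a a;
  tlt_trans : forall a b c, tlt a b -> tlt b c -> tlt a c;
  tlt_tree : forall a b c, tlt a c -> tlt b c -> [\/ a = b, tlt a b | tlt b a];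
  tlt_lt : forall a b, tlt a b -> a < b
}.

Definition tle (T : finite_tree) a b : Prop := a = b \/ tlt T a b.

Definition maximal_node (T : finite_tree) a : Prop :=
  nodes T a /\ forall b, ~ tlt T a b.

Definition end_extends (U T : finite_tree) : Prop :=
  nodes T `<=` nodes U /\
  forall a b, nodes T a -> nodes T b -> (tlt U a b <-> tlt T a b).

(* The partial function F is given as a function to [option W]. *)
Record cond : Type := Cond {
  ctree : finite_tree;
  cfun : W -> option W;
  cmod : set (set W);
  cfun_dom : forall a, cfun a <> None <-> maximal_node ctree a;
  cfun_inj : forall a b, cfun a <> None -> cfun a = cfun b -> a = b;
  cmod_finite : finite_set cmod;
  cmod_adequate : adequate cmod;
  cmod_below : forall M a b i j, cmod M ->
    maximal_node ctree a -> maximal_node ctree b -> a <> b ->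
    cfun a = Some i -> cfun b = Some j -> M i -> M j ->
    forall c, tlt ctree c a -> tlt ctree c b -> M c
}.

Definition cond_le (q p : cond) : Prop :=
  [/\ end_extends (ctree q) (ctree p),
      cmod p `<=` cmod q
    & forall a, maximal_node (ctree p) a ->
        exists b, [/\ maximal_node (ctree q) b, tle (ctree q) a b
                    & cfun p a = cfun q b]].

End Models.

(* [Name f c] is the name {(f i, c i) : i in A}. *)
Inductive name (P : Type) : Type :=
  Name (A : Type) (f : A -> name P) (c : A -> P).

Section Forcing.
Variables (P : Type) (le : P -> P -> Prop).

(* A sentence of the forcing language is interpreted as the set of conditions
   forcing it; quantifiers range over names. *)
Definition fprop : Type := P -> Prop.
Implicit Types (phi psi : fprop) (p q r : P) (x y z f : name P).

Definition dense_below (D : P -> Prop) : fprop :=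
  fun p => forall q, le q p -> exists2 r, le r q & D r.

Definition fnot phi : fprop := fun p => forall q, le q p -> ~ phi q.
Definition fand phi psi : fprop := fun p => phi p /\ psi p.
Definition for_ phi psi : fprop := dense_below (fun q => phi q \/ psi q).
Definition fimp phi psi : fprop := fun p => forall q, le q p -> phi q -> psi q.
Definition fall (phi : name P -> fprop) : fprop := fun p => forall x, phi x p.
Definition fex (phi : name P -> fprop) : fprop :=
  dense_below (fun q => exists x, phi x q).

(* x = y is forced as "x is a subset of y and y is a subset of x". *)
Fixpoint feq (x y : name P) : fprop := fun p =>
  match x, y with
  | Name A f c, Name B g e =>
      (forall i q, le q p -> le q (c i) ->
         dense_below (fun r => exists2 j, le r (e j) & feq (f i) (g j) r) q) /\
      (forall j q, le q p -> le q (e j) ->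
         dense_below (fun r => exists2 i, le r (c i) & feq (f i) (g j) r) q)
  end.

Definition fmem (x y : name P) : fprop :=
  let: Name A g e := y in
  dense_below (fun r => exists2 j, le r (e j) & feq x (g j) r).

Local Notation "x ≐ y" := (feq x y) (at level 70, no associativity).
Local Notation "x ∊ y" := (fmem x y) (at level 70, no associativity).
Local Notation "¬' phi" := (fnot phi) (at level 75, right associativity).
Local Notation "phi ⊓ psi" := (fand phi psi) (at level 80, right associativity).
Local Notation "phi ⊔ psi" := (for_ phi psi) (at level 85, right associativity).
Local Notation "phi ⇒ psi" := (fimp phi psi) (at level 90, right associativity).
Local Notation "⋀ x , phi" := (fall (fun x => phi)) (at level 95, x name).
Local Notation "⋁ x , phi" := (fex (fun x => phi)) (at level 95, x name).
Local Notation "⋀ x ∊ A , phi" := (fall (fun x => fimp (fmem x A) phi))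
  (at level 95, x name, A at level 69).
Local Notation "⋁ x ∊ A , phi" := (fex (fun x => fand (fmem x A) phi))
  (at level 95, x name, A at level 69).

(* check-names: every condition is paired with every element *)
Fixpoint check (x : V) : name P :=
  let: VSup A f := x in
  Name (fun i : A * P => check (f i.1)) (fun i => i.2).

(* names for {x, y} and for Kuratowski's (x, y) *)
Definition upair x y : name P :=
  Name (fun i : bool * P => if i.1 then x else y) (fun i => i.2).
Definition opair x y : name P := upair (upair x x) (upair x y).

(* f is an injection with domain x all of whose values satisfy Q *)
Definition finjection f x (Q : name P -> fprop) : fprop :=
  (⋀ z ∊ f, ⋁ a ∊ x, ⋁ b, Q b ⊓ z ≐ opair a b)
  ⊓ (⋀ a ∊ x, ⋁ b, opair a b ∊ f)
  ⊓ (⋀ a, ⋀ b, ⋀ b', opair a b ∊ f ⇒ opair a b' ∊ f ⇒ b ≐ b')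
  ⊓ (⋀ a, ⋀ a', ⋀ b, opair a b ∊ f ⇒ opair a' b ∊ f ⇒ a ≐ a').

Definition finjects x y : fprop := ⋁ f, finjection f x (fun b => b ∊ y).

Definition ftransitive x : fprop := ⋀ y ∊ x, ⋀ z ∊ y, z ∊ x.
Definition fordinal x : fprop := ftransitive x ⊓ (⋀ y ∊ x, ftransitive y).
Definition flimit x : fprop :=
  fordinal x ⊓ (⋁ y, y ∊ x) ⊓ (⋀ y ∊ x, ⋁ z ∊ x, y ∊ z).
Definition fomega x : fprop := flimit x ⊓ (⋀ y ∊ x, ¬' flimit y).
(* k is the least ordinal that does not inject into m *)
Definition fsucc_cardinal m k : fprop :=
  fordinal k ⊓ ¬' finjects k m ⊓ (⋀ a ∊ k, finjects a m).
Definition fomega1 x : fprop := ⋁ w, fomega w ⊓ fsucc_cardinal w x.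
Definition fomega2 x : fprop := ⋁ w, fomega1 w ⊓ fsucc_cardinal w x.

Definition fcomparable R x y : fprop := x ≐ y ⊔ opair x y ∊ R ⊔ opair y x ∊ R.

(* b is a cofinal branch of the tree (X, R), where X is an ordinal: a maximal
   chain, unbounded in X *)
Definition fbranch X R b : fprop :=
  (⋀ x ∊ b, x ∊ X)
  ⊓ (⋀ x ∊ b, ⋀ y ∊ b, fcomparable R x y)
  ⊓ (⋀ x ∊ X, (⋀ y ∊ b, fcomparable R x y) ⇒ x ∊ b)
  ⊓ (⋀ x ∊ X, ⋁ y ∊ b, x ∊ y).

Definition fomega2_branches X R : fprop :=
  ⋁ k, fomega2 k ⊓ (⋁ f, finjection f k (fbranch X R)).

Definition forced phi : Prop := forall p, phi p.

Definition preserves_omega12 {d : Order.disp_t} (W : omega2Type d) : Prop :=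
  forced (fomega1 (check (vord (w1 : W)))) /\
  forced (fomega2 (check (vset_of [set: W]))).

End Forcing.

Section GenericTree.
Context {d : Order.disp_t} {W : omega2Type d}.
Variables (pi : W -> zset) (Y : set (set W)) (Gamma : set W).
Notation P := (cond pi Y Gamma).

Definition omega1_name : name P := check P (vord (w1 : W)).

(* the name {((a, b), p) : a <_T b, where p = (T, F, A)} *)
Definition Rdot : name P :=
  Name (fun t : {t : (W * W) * P | tlt (ctree t.2) t.1.1 t.1.2} =>
          opair (check P (vord (sval t).1.1)) (check P (vord (sval t).1.2)))
       (fun t => (sval t).2).

End GenericTree.

(* Main.v *)
(* For i < omega_2 let b_i be the set of nodes alpha such that some (T, F, A)
   in the generic filter has a maximal node a with F(a) = i and alpha <=_T a.
   Densely a new top node with F-value i can be put above b_i, at any height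
   below omega_1: condition (4) survives because the new node has below it only
   nodes that are below the node it replaces.  Hence b_i is unbounded; being
   unbounded and closed downwards, it is a maximal chain.  If i and j are both
   in the range of F, the nodes carrying them are incomparable, so b_i and b_j
   differ.  As omega_2 is preserved, {(i, b_i) : i < omega_2} is the required
   injection. *)
Require Import Defs.
From mathcomp Require Import all_boot all_order.
From mathcomp Require Import boolp classical_sets functions cardinality.
From Stdlib Require Import RelationClasses.

Local Open Scope classical_set_scope.
Local Open Scope card_scope.

(** * Forced equality and membership over an arbitrary preorder *)

Section ForcingTheory.
Set Implicit Arguments.
Unset Strict Implicit.
Context {P : Type} {le : P -> P -> Prop} {le_preorder : PreOrder le}.
Implicit Types (p q r : P) (D E : P -> Prop).

Let le_refl p : le p p.
Proof. exact: PreOrder_Reflexive. Qed.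

Let le_trans {q p r} : le p q -> le q r -> le p r.
Proof. exact: PreOrder_Transitive. Qed.

Lemma dense_below_le D p q : le q p -> dense_below le D p -> dense_below le D q.
Proof. by move=> qp H r rq; apply: H; apply: le_trans rq qp. Qed.

Lemma dense_below_always D p : (forall q, le q p -> D q) -> dense_below le D p.
Proof. by move=> H q qp; exists q; [exact: le_refl | exact: H]. Qed.

Lemma dense_below_bind D E p : dense_below le D p ->
  (forall r, le r p -> D r -> dense_below le E r) -> dense_below le E p.
Proof.
move=> H K q qp; have [r rq Dr] := H q qp.
have [s sr Es] := K r (le_trans rq qp) Dr r (le_refl r).
by exists s => //; apply: le_trans sr rq.
Qed.

Lemma dense_below_impl D E p : dense_below le D p ->
  (forall r, le r p -> D r -> E r) -> dense_below le E p.
Proof.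
move=> H K q qp; have [r rq Dr] := H q qp.
by exists r => //; apply: K => //; apply: le_trans rq qp.
Qed.

Lemma feq_le (x y : name P) p q : le q p -> feq le x y p -> feq le x y q.
Proof.
case: x y => [A f c] [B g e] qp /= [H1 H2]; split=> i r rq;
  [apply: H1|apply: H2]; exact: le_trans rq qp.
Qed.

(** Both clauses of [feq] end in a [dense_below], which absorbs the outer density. An equality may
    therefore be decided after passing to stronger conditions. *)
Lemma feq_dense {x y : name P} {p} : dense_below le (feq le x y) p -> feq le x y p.
Proof.
case: x y => [A f c] [B g e] H; split=> i q qp qc;
  apply: (dense_below_bind (dense_below_le qp H)) => r rq [H1 H2];
  [apply: H1|apply: H2]; by [exact: le_refl|exact: le_trans rq qc].
Qed.

Lemma feq_refl (x : name P) p : feq le x x p.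
Proof.
elim: x p => A f IH c p /=.
by split=> i q qp qc; apply: dense_below_always => r rq; exists i;
  rewrite // ; apply: le_trans rq qc.
Qed.

Lemma feq_sym {x y : name P} {p} : feq le x y p -> feq le y x p.
Proof.
elim: x y p => A f IH c [B g e] p /= [H1 H2].
by split=> i q qp qc; [have := H2 i q qp qc|have := H1 i q qp qc];
  move/dense_below_impl; apply=> r rq [j ? ?]; exists j => //; apply: IH.
Qed.

Lemma feq_trans {x y z : name P} {p} : feq le x y p -> feq le y z p -> feq le x z p.
Proof.
elim: x y z p => A f IH c [B g e] [C h k] p /= [H1 H2] [K1 K2].
split=> i q qp qc.
  apply: (dense_below_bind (H1 i q qp qc)) => r rq [j rj ij].
  apply: (dense_below_impl (K1 j r (le_trans rq qp) rj)) => s sr [l sl jl].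
  by exists l => //; apply: IH jl; apply: feq_le ij.
apply: (dense_below_bind (K2 i q qp qc)) => r rq [j rj ij].
apply: (dense_below_impl (H2 j r (le_trans rq qp) rj)) => s sr [l sl jl].
by exists l => //; apply: IH jl _; apply: feq_le ij.
Qed.

Lemma fmem_le (x y : name P) p q : le q p -> fmem le x y p -> fmem le x y q.
Proof. by case: y => B g e; apply: dense_below_le. Qed.

Lemma fmem_dense {x y : name P} {p} : dense_below le (fmem le x y) p -> fmem le x y p.
Proof.
case: y => B g e H; apply: (dense_below_bind H) => r rp; exact.
Qed.

Lemma fmem_eql {x x' y : name P} {p} : feq le x x' p -> fmem le x y p -> fmem le x' y p.
Proof.
case: y => B g e xx' H; apply: (dense_below_impl H) => r rp [j rj xj].
by exists j => //; apply: feq_trans xj; apply: feq_sym; apply: feq_le xx'.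
Qed.

Lemma fmem_eqr {x y y' : name P} {p} : feq le y y' p -> fmem le x y p -> fmem le x y' p.
Proof.
case: y y' => B g e [C h k] [H _] xy.
apply: (dense_below_bind xy) => r rp [j rj xj].
apply: (dense_below_impl (H j r rp rj)) => s sr [l sl jl].
by exists l => //; apply: feq_trans jl; apply: feq_le xj.
Qed.

(** Below [c i] the listed name [f i] is forced into [x], so the hypothesis at [z := f i] yields one
    clause of [feq]; the listed names of [y] yield the other. *)
Lemma feq_ext {x y : name P} {p} :
  (forall z q, le q p -> fmem le z x q <-> fmem le z y q) -> feq le x y p.
Proof.
case: x y => A f c [B g e] H; split=> i q qp qc.
  apply/(H (f i) q qp); apply: dense_below_always => r rq.
  by exists i; [exact: le_trans rq qc|exact: feq_refl].
have : fmem le (g i) (Name f c) q.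
  apply/(H (g i) q qp); apply: dense_below_always => r rq.
  by exists i; [exact: le_trans rq qc|exact: feq_refl].
by move/dense_below_impl; apply=> r rq [j ? ?]; exists j => //; apply: feq_sym.
Qed.

(** * Unordered pairs and Kuratowski pairs *)

Lemma fmem_upair {x y z : name P} {p} :
  fmem le z (upair x y) p <-> for_ le (feq le z x) (feq le z y) p.
Proof.
split=> /dense_below_impl; apply=> r rp.
  by case=> -[[] q] /= _ H; [left|right].
by case=> H; [exists (true, r)|exists (false, r)] => //; apply: le_refl.
Qed.

Lemma feq_upair (x x' y y' : name P) p : feq le x x' p -> feq le y y' p ->
  feq le (upair x y) (upair x' y') p.
Proof.
move=> xx' yy'; apply: feq_ext => z q qp; rewrite !fmem_upair.
split=> /dense_below_impl; apply=> r rq; have rp := le_trans rq qp;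
  case=> H; [left|right|left|right]; apply: (feq_trans H);
  by [apply: feq_le rp _|apply: feq_sym; apply: feq_le rp _].
Qed.

Lemma feq_opair (x x' y y' : name P) p : feq le x x' p -> feq le y y' p ->
  feq le (opair x y) (opair x' y') p.
Proof. by move=> xx' yy'; do 2?apply: feq_upair. Qed.

Lemma fmem_upairl {x y : name P} {p} : fmem le x (upair x y) p.
Proof.
by apply/fmem_upair; apply: dense_below_always => q _; left; apply: feq_refl.
Qed.

Lemma fmem_upairr {x y : name P} {p} : fmem le y (upair x y) p.
Proof.
by apply/fmem_upair; apply: dense_below_always => q _; right; apply: feq_refl.
Qed.

Lemma fmem_upair_same {x z : name P} {p} : fmem le z (upair x x) p -> feq le z x p.
Proof.
by move/fmem_upair => H; apply: feq_dense; apply: (dense_below_impl H) => r _ [].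
Qed.

Lemma feq_opair_inj {x x' y y' : name P} {p} :
  feq le (opair x y) (opair x' y') p -> feq le x x' p /\ feq le y y' p.
Proof.
move=> H; have xx' : feq le x x' p.
  apply: feq_dense.
  (* [{x}] equals [{x'}] or [{x', y'}]; either way [x'] is a member of [{x}]. *)
  have /fmem_upair /dense_below_impl := fmem_eqr H fmem_upairl.
  apply=> r rp [] K; apply: feq_sym; apply: fmem_upair_same;
    apply: (fmem_eqr (feq_sym K)); exact: fmem_upairl.
split=> //; apply: feq_dense.
have /fmem_upair /dense_below_bind := fmem_eqr H fmem_upairr.
apply=> r rp K.
have xx'r : feq le x x' r by apply: feq_le xx'.
(* If y = x', then also x = y, so the members of the members of (x, y) all equal y; y' is one of them. *)
have yx' s : le s r -> feq le y x' s -> feq le y y' s.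
  move=> sr yx'; have sp := le_trans sr rp.
  have yx : feq le y x s.
    by apply: (feq_trans yx'); apply: feq_sym; apply: feq_le xx'r.
  have /fmem_upair M := fmem_eqr (feq_sym (feq_le sp H)) fmem_upairr.
  apply: feq_dense; apply: (dense_below_bind M) => t ts N.
  have yxt := feq_le ts yx.
  apply: dense_below_always => u ut; have yxu := feq_le ut yxt.
  case: N => N; have /fmem_upair N' := fmem_eqr (feq_le ut N) fmem_upairr;
    apply: feq_dense; apply: (dense_below_impl N') => v vu;
    case=> /feq_sym Ny'; by [|apply: (feq_trans (feq_le vu yxu))].
(* [K] says that [{x, y}] equals [{x'}] or [{x', y'}], and [y] is a member of it. *)
have : dense_below le (fun s => feq le y x' s \/ feq le y y' s) r.
  case: K => /fmem_eqr /(_ fmem_upairr) /fmem_upair // /dense_below_impl.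
  by apply=> s _ []; left.
move/dense_below_impl; apply=> s sr [|//]; exact: yx'.
Qed.

(** * Check names of ordinals *)

Context {d : Order.disp_t} {W : omega2Type d}.
Implicit Types (a b g : W) (A : set W).

(** Unfolding the recursion once lets a single membership lemma serve both [vord] and [vset_of]. *)
Lemma vordE b : vord b = vset_of (seg b).
Proof.
rewrite /vord Fix_eq // => x f g fg; congr VSup.
by apply: funext => i; apply: fg.
Qed.

Lemma fmem_check_vset A (x : name P) p : fmem le x (check P (vset_of A)) p <->
  dense_below le (fun r => exists2 a, A a & feq le x (check P (vord a)) r) p.
Proof.
split=> /dense_below_impl; apply=> r rp.
  by case=> -[[a Aa] q] /= _ xa; exists a.
by case=> a Aa xa; exists (exist _ a Aa, r) => //; apply: le_refl.
Qed.

Lemma fmem_check_vord b (x : name P) p : fmem le x (check P (vord b)) p <->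
  dense_below le
    (fun r => exists2 a, (a < b)%O & feq le x (check P (vord a)) r) p.
Proof. by rewrite vordE; apply: fmem_check_vset. Qed.

Lemma fmem_check_lt a b p : (a < b)%O ->
  fmem le (check P (vord a)) (check P (vord b)) p.
Proof.
move=> ab; apply/fmem_check_vord; apply: dense_below_always => r _.
by exists a => //; apply: feq_refl.
Qed.

Lemma feq_check_inj a b p :
  feq le (check P (vord a)) (check P (vord b)) p -> a = b.
Proof.
have neq : forall a b p, (b < a)%O ->
    ~ feq le (check P (vord a)) (check P (vord b)) p.
  elim/(well_founded_ind (@omega2_wf d W)) => {}a IH {}b {}p ba ab.
  have /fmem_check_vord /(_ p (le_refl p)) [r rp [c cb bc]] :=
    fmem_eqr ab (fmem_check_lt p ba).
  exact: IH bc.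
move=> ab; have [lt|lt|//] := Order.TotalTheory.ltgtP a b; last by case: (neq _ _ p lt ab).
by case: (neq _ _ p lt (feq_sym ab)).
Qed.

Lemma check_unique (x : name P) a b p :
  feq le x (check P (vord a)) p -> feq le x (check P (vord b)) p -> a = b.
Proof. by move=> xa xb; apply: (@feq_check_inj _ _ p); apply: (feq_trans (feq_sym xa)). Qed.

End ForcingTheory.

(** * The order on conditions and the finite approximations to the branches *)

Section Extension.
Set Implicit Arguments.
Unset Strict Implicit.
Context {d : Order.disp_t} {W : omega2Type d}.
Context { pi : W -> zset } {Y : set (set W)} {Gamma : set W}.
Notation P := (cond pi Y Gamma).
Notation le := (@cond_le d W pi Y Gamma).
Implicit Types (p q r : P) (a b c i x : W).

Lemma cond_le_refl p : le p p.
Proof. by split=> [||a ma]; [split| |exists a; split=> //; left]. Qed.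

Lemma cond_leP q p : le q p -> forall a b, tlt (ctree p) a b -> tlt (ctree q) a b.
Proof. by case=> -[_ H] _ _ a b ab; apply/H => //; have [] := tlt_nodes ab. Qed.

Lemma tle_le q p a b : le q p -> tle (ctree p) a b -> tle (ctree q) a b.
Proof. by move=> qp [->|/(cond_leP qp)]; [left|right]. Qed.

Lemma tle_trans (T : @finite_tree d W) a b c : tle T a b -> tle T b c -> tle T a c.
Proof.
by case=> [->//|ab] [<-|bc]; right=> //; apply: tlt_trans bc.
Qed.

Lemma cond_le_trans q p r : le p q -> le q r -> le p r.
Proof.
move=> pq qr; have [[n1 e1] m1 f1] := pq; have [[n2 e2] m2 f2] := qr.
split; first split; first exact: subset_trans n1.
- by move=> a b na nb; rewrite e1 ?e2 //; exact: n2.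
- exact: subset_trans m1.
- move=> a ma; have [b [mb ab ->]] := f2 a ma.
  have [c [mc bc ->]] := f1 b mb; exists c; split=> //.
  by apply: tle_trans bc; apply: tle_le ab.
Qed.

#[export] Instance cond_le_preorder : PreOrder le.
Proof. by split; [exact: cond_le_refl|move=> p q r; exact: cond_le_trans]. Qed.

(** The finite part of the branch b_i fixed by [p]; it is empty when [i] is not a value of
    [cfun p]. *)
Definition in_branch p i a : Prop :=
  exists2 b, cfun p b = Some i & tle (ctree p) a b.

(** A stronger condition can move the value [i] only upwards in the tree, so the approximations
    grow. *)
Lemma in_branch_le q p i a : le q p -> in_branch p i a -> in_branch q i a.
Proof.
move=> qp [b bi ab]; have mb : maximal_node (ctree p) b.
  by apply/cfun_dom; rewrite bi.
have [_ _ /(_ b mb) [c [_ bc pq]]] := qp.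
by exists c; [rewrite -pq|apply: tle_trans bc; apply: tle_le ab].
Qed.

Lemma in_branch_node p i a : in_branch p i a -> nodes (ctree p) a.
Proof.
case=> b bi [->|/tlt_nodes[]//].
by have /cfun_dom[] : cfun p b <> None by rewrite bi.
Qed.

(** Injectivity of [cfun p] leaves a single node with value [i], and the nodes below one node of a
    tree are comparable. *)
Lemma in_branch_chain p i a b : in_branch p i a -> in_branch p i b ->
  [\/ a = b, tlt (ctree p) a b | tlt (ctree p) b a].
Proof.
move=> [x xi ax] [y yi by_].
have exy : x = y by apply: (@cfun_inj _ _ _ _ _ p); rewrite xi ?yi.
subst y; case: ax by_ => [->|ax] [->|bx]; first exact: Or31; first exact: Or33.
  exact: Or32.
exact: tlt_tree bx.
Qed.

Lemma in_branch_down p i a b :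
  tlt (ctree p) a b -> in_branch p i b -> in_branch p i a.
Proof.
by move=> ab [x xi bx]; exists x => //; apply: tle_trans bx; right.
Qed.

Lemma countable_le_w1 x : (x < w1)%O -> countable [set a : W | (a <= x)%O].
Proof.
move=> /w1_least xc; apply: (@sub_countable _ _ _
    (\bigcup_(e in [set: bool]) if e then [set a | (a < x)%O] else [set x])).
  apply: subset_card_le => a /=; rewrite Order.POrderTheory.le_eqVlt.
  by case/orP => [/eqP ->|ax]; [exists false|exists true].
by apply: bigcup_countable => [|[] _]; [exact: countableP|exact: xc|exact: countable1].
Qed.

(** Without a bound, omega_1 would be covered by finitely many countable segments, one for each
    member of [A]. *)
Lemma finite_bound_w1 (A : set W) : finite_set A -> A `<=` seg w1 ->
  exists2 x, (x < w1)%O & forall a, A a -> (a < x)%O.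
Proof.
move=> finA Aw1; apply: contrapT => H.
apply: (@w1_uncountable d W).
have : countable (\bigcup_(a in A) [set x : W | (x <= a)%O]).
  apply: bigcup_countable; first exact: finite_set_countable.
  by move=> a /Aw1 /countable_le_w1.
apply: sub_countable; apply: subset_card_le => x xw1 /=.
apply: contrapT => K; apply: H; exists x => // a Aa.
rewrite Order.TotalTheory.ltNge; apply/negP => xa; apply: K.
by exists a.
Qed.

(** * Adding a new top node [x] with value [i] *)

Section AddTop.
Context (p : P) (i x : W).
Context (xw1 : (x < w1)%O).
Context (xtop : forall a, nodes (ctree p) a -> (a < x)%O).
Let T := ctree p.
Let D := in_branch p i.

Lemma top_fresh : ~ nodes T x.
Proof. by move/xtop; rewrite Order.POrderTheory.ltxx. Qed.

#[local] Obligation Tactic := idtac.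

(** If no node carries [i] yet, [D] is empty and [x] is an isolated root, so the same construction
    also brings [i] into the range. *)
Program Definition top_tree : @finite_tree d W :=
  @FiniteTree d W (nodes T `|` [set x])
    (fun a b => tlt T a b \/ D a /\ b = x) _ _ _ _ _ _ _.
Next Obligation. by rewrite finite_setU; split => //; apply: nodes_finite. Qed.
Next Obligation. by move=> a [/nodes_w1|->]. Qed.
Next Obligation.
move=> a b [/tlt_nodes[]|[/in_branch_node Da ->]]; first by split; left.
by split; [left|right].
Qed.
Next Obligation.
move=> a [/tlt_irr//|[/in_branch_node n ax]].
by apply: top_fresh; rewrite -ax.
Qed.
Next Obligation.
move=> a b c [ab|[Da bx]] [bc|[Db ->]].
- by left; apply: tlt_trans bc.
- by right; split=> //; apply: in_branch_down Db.
- by case: top_fresh; rewrite -bx; case: (tlt_nodes bc).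
- by right.
Qed.
Next Obligation.
move=> a b c [ac|[Da cx']] [bc|[Db cx]].
- by case: (tlt_tree ac bc) => H; [constructor 1|constructor 2; left|constructor 3; left].
- by case: top_fresh; rewrite -cx; case: (tlt_nodes ac).
- by case: top_fresh; rewrite -cx'; case: (tlt_nodes bc).
- by case: (in_branch_chain Da Db) => H; [constructor 1|constructor 2; left|constructor 3; left].
Qed.
Next Obligation. by move=> a b [/tlt_lt//|[/in_branch_node /xtop ? ->]]. Qed.

(** The old carrier of [i], if any, lies in [D], stops being maximal and hands its value to [x]. The
    other members of [D] were not maximal and had no value. *)
Definition top_fun a : option W :=
  if a == x then Some i else if pselect (D a) then None else cfun p a.

Lemma top_fun_x : top_fun x = Some i.
Proof. by rewrite /top_fun eqxx. Qed.

Lemma top_fun_D a : D a -> top_fun a = None.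
Proof.
move=> Da; rewrite /top_fun; case: eqP => [ax|_]; last by case: pselect.
by case: top_fresh; rewrite -ax; apply: in_branch_node Da.
Qed.

Lemma top_fun_old a : a <> x -> ~ D a -> top_fun a = cfun p a.
Proof. by rewrite /top_fun; case: eqP => // _; case: pselect. Qed.

Lemma top_fun_Some a j : top_fun a = Some j ->
  (a = x /\ j = i) \/ [/\ cfun p a = Some j, a <> x & ~ D a].
Proof.
rewrite /top_fun; case: eqP => [-> [<-]|ax]; first by left.
by case: pselect => // nD H; right.
Qed.

Lemma top_maximal_x : maximal_node top_tree x.
Proof.
split; first by right.
move=> b [/tlt_nodes[/top_fresh//]|[/in_branch_node/top_fresh//]].
Qed.

Lemma top_maximal_old a : a <> x -> ~ D a ->
  maximal_node top_tree a <-> maximal_node T a.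
Proof.
move=> ax nD; split=> -[na H]; split.
- by case: na.
- by move=> b ab; apply: (H b); left.
- by left.
- by move=> b [/H//|[/nD]].
Qed.

Program Definition top_cond : P :=
  @Cond d W pi Y Gamma top_tree top_fun (cmod p) _ _ _ _ _.
Next Obligation.
move=> a; have [->|ax] := pselect (a = x).
  by rewrite top_fun_x; split=> // _; apply: top_maximal_x.
have [Da|nD] := pselect (D a).
  rewrite top_fun_D //; split=> // -[_ /(_ x)]; case; by right.
by rewrite top_fun_old // cfun_dom top_maximal_old.
Qed.
Next Obligation.
move=> a b; case Ea: (top_fun a) => [j|//] _ /esym Eb.
have [[-> ji]|[aj _ nD]] := top_fun_Some Ea;
  have [[-> ji']|[bj _ nD']] := top_fun_Some Eb => //.
(* An old node with value [i] would lie in [D], where values have been erased. *)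
- by case: nD'; exists b; [rewrite bj ji|left].
- by case: nD; exists a; [rewrite aj ji'|left].
- by apply: (@cfun_inj _ _ _ _ _ p); rewrite aj ?bj.
Qed.
Next Obligation. exact: cmod_finite. Qed.
Next Obligation. exact: cmod_adequate. Qed.
Next Obligation.
move=> M a b j k MM _ _ ab aj_ bk_ Mj Mk c /= ca cb.
have max u l : cfun p u = Some l -> maximal_node T u.
  by move=> uk; apply/cfun_dom; rewrite uk.
(* Below the new node x lie only nodes below the old maximal node with value i. *)
have key u l : cfun p u = Some l -> ~ D u -> M i -> M l ->
    tlt T c u -> D c -> M c.
  move=> ul nDu Mi Ml cu [e ei ce].
  have ue : u <> e by move=> ue; apply: nDu; exists e => //; left.
  case: ce => [ce|ce].
    by have [_ /(_ u)[]] := max e i ei; rewrite -ce.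
  exact: (@cmod_below _ _ _ _ _ p M u e l i _ (max _ _ ul) (max _ _ ei)).
have old u : u <> x -> tlt T c u \/ D c /\ u = x -> tlt T c u.
  by move=> ux [|[_ /ux]].
have topD : tlt T c x \/ D c /\ x = x -> D c.
  by case=> [/tlt_nodes[_ /top_fresh]|[]].
have [[ax ji]|[aj ax nDa]] := top_fun_Some aj_;
  have [[bx ji']|[bj bx nDb]] := top_fun_Some bk_.
- by case: ab; rewrite ax bx.
- by subst a; apply: (key b k) => //; [rewrite -ji|apply: old|apply: topD].
- by subst b; apply: (key a j) => //; [rewrite -ji'|apply: old|apply: topD].
- by apply: (@cmod_below _ _ _ _ _ p M a b j k) => //;
    [apply: max aj|apply: max bj|apply: old|apply: old].
Qed.

Lemma top_cond_le : le top_cond p.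
Proof.
split=> //; first split=> [a na|a b na nb]; first by left.
  split=> [[//|[_ bx]]|]; last by left.
  by case: top_fresh; rewrite -bx.
move=> a ma; have [na nlt] := ma.
have ax : a <> x by move=> ax; apply: top_fresh; rewrite -ax.
(* A maximal node in [D] can only be the old carrier of [i], and [x] replaces it; every other
   maximal node stays maximal and keeps its value. *)
have [Da|nD] := pselect (D a).
  exists x; split; [exact: top_maximal_x|by right; right|].
  rewrite /= top_fun_x; case: Da => b bi [->//|ab].
  by case: (nlt b).
exists a; split; [exact/top_maximal_old|by left|].
by rewrite /= top_fun_old.
Qed.

End AddTop.

(** The density argument behind distinctness, maximality and unboundedness of the branches. The new
    top node is chosen above [a] and above all nodes of [p]. *)
Lemma extend_branch p i a : (a < w1)%O ->
  exists2 q, le q p & exists2 x, cfun q x = Some i & (a < x)%O.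
Proof.
move=> aw1; have [||x xw1 xtop] := @finite_bound_w1 (nodes (ctree p) `|` [set a]).
- by rewrite finite_setU; split=> //; apply: nodes_finite.
- by move=> b [/nodes_w1|->].
have xT b : nodes (ctree p) b -> (b < x)%O by move=> nb; apply: xtop; left.
exists (top_cond i xw1 xT); first exact: top_cond_le.
by exists x; [exact: top_fun_x|apply: xtop; right].
Qed.

(** * Names for the branches, their distinctness and cofinality *)

Definition branch_name i : name P :=
  Name (fun t : {t : W * P | in_branch t.2 i t.1} => check P (vord (sval t).1))
    (fun t => (sval t).2).

(** As approximations grow, the condition attached to a node in the name may be replaced by any
    stronger [r]. *)
Lemma fmem_branch_name i (x : name P) p : fmem le x (branch_name i) p <->
  dense_below le
    (fun r => exists2 a, in_branch r i a & feq le x (check P (vord a)) r) p.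
Proof.
split=> H; apply: (dense_below_impl H) => r rp.
  by case=> -[[a q] /= qa] rq xa; exists a => //; apply: in_branch_le qa.
by case=> a ra xa; exists (exist _ (a, r) ra) => //; apply: cond_le_refl.
Qed.

Lemma fmem_check_branch_name p i a :
  in_branch p i a -> fmem le (check P (vord a)) (branch_name i) p.
Proof.
move=> pa; apply/fmem_branch_name; apply: dense_below_always => q qp.
by exists a; [apply: in_branch_le pa|apply: feq_refl].
Qed.

Lemma fmem_Rdot (x y : name P) p : fmem le (opair x y) (Rdot pi Y Gamma) p <->
  dense_below le (fun r => exists a b, [/\ tlt (ctree r) a b,
    feq le x (check P (vord a)) r & feq le y (check P (vord b)) r]) p.
Proof.
split=> H; apply: (dense_below_impl H) => r rp.
  case=> -[[[a b] q] /= ab] rq /feq_opair_inj[xa yb].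
  by exists a, b; split=> //; apply: cond_leP ab.
case=> a [b [ab xa yb]]; exists (exist _ ((a, b), r) ab).
  exact: cond_le_refl.
exact: feq_opair.
Qed.

Lemma branch_name_inj i j p :
  feq le (branch_name i) (branch_name j) p -> i = j.
Proof.
move=> ij.
(* Any countable ordinal serves as height in the two extensions, which put [i] and then [j] into the
   range; a bound of the empty set provides one. *)
have [a0 a0w1] : exists a : W, (a < w1)%O.
  by have [||a] := @finite_bound_w1 set0 => // aw1 _; exists a.
have [q qp [a ai _]] := extend_branch p i a0w1.
have [r rq [b bj _]] := extend_branch q j a0w1.
have ra : in_branch r i a by apply: (in_branch_le rq); exists a => //; left.
have [c ci ac] := ra.
have rj : fmem le (check P (vord c)) (branch_name j) r.
  apply: (fmem_eqr (feq_le (cond_le_trans rq qp) ij)).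
  by apply: fmem_check_branch_name; exists c => //; left.
have [s sr [e sje ce]] := (fmem_branch_name _ _ _).1 rj _ (cond_le_refl r).
rewrite -{e ce}(feq_check_inj ce) in sje.
have sjb : in_branch s j b by apply: (in_branch_le sr); exists b => //; left.
have mc : maximal_node (ctree r) c by apply/cfun_dom; rewrite ci.
have mb : maximal_node (ctree r) b by apply/cfun_dom; rewrite bj.
(* [s] adds no relation between nodes of [r], so the maximal nodes [b] and [c] of [r], comparable in
   [s], must coincide. *)
have [[_ es] _ _] := sr.
case: (in_branch_chain sje sjb) => [cb|cb|bc].
- by move: ci; rewrite cb bj => -[].
- by case: mc => nc /(_ b)[]; apply/es => //; case: mb.
- by case: mb => nb /(_ c)[]; apply/es => //; case: mc.
Qed.

Lemma fbranch_branch_name i p :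
  fbranch le (omega1_name pi Y Gamma) (Rdot pi Y Gamma) (branch_name i) p.
Proof.
split; [|split; [|split]].
- move=> x q qp /fmem_branch_name xb; apply/fmem_check_vord.
  apply: (dense_below_impl xb) => r rq [a /in_branch_node /nodes_w1 aw1 xa].
  by exists a.
- move=> x q qp xb y r rq /fmem_branch_name yb.
  have /fmem_branch_name {}xb : fmem le x (branch_name i) r by apply: fmem_le xb.
  apply: (dense_below_bind xb) => s sr [a sa xa].
  apply: (dense_below_impl (dense_below_le sr yb)) => t ts [b tb yb'].
  have {}sa := in_branch_le ts sa.
  have {}xa : feq le x (check P (vord a)) t by apply: feq_le xa.
  case: (in_branch_chain sa tb) => [ab|ab|ba].
  + by left; apply: (feq_trans xa); rewrite ab; apply: feq_sym.
  + right; apply: dense_below_always => u ut; left; apply/fmem_Rdot.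
    apply: dense_below_always => v vu; have vt := cond_le_trans vu ut.
    by exists a, b; split; [apply: cond_leP ab|apply: feq_le xa|apply: feq_le yb'].
  + right; apply: dense_below_always => u ut; right; apply/fmem_Rdot.
    apply: dense_below_always => v vu; have vt := cond_le_trans vu ut.
    by exists b, a; split; [apply: cond_leP ba|apply: feq_le yb'|apply: feq_le xa].
- move=> x q qp /fmem_check_vord xw1 r rq cmp; apply: fmem_dense => s sr.
  have [t ts [a aw1 xa]] := xw1 s (cond_le_trans sr rq).
  (* A branch node [b] of larger height than [a] forces the direction: the tree order respects the
     ordinal order, so comparability leaves only [a] below [b], and the branch is closed
     downwards. *)
  have [u ut [b bi ab]] := extend_branch t i aw1.
  have us := cond_le_trans ut ts.
  have ub : fmem le (check P (vord b)) (branch_name i) u.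
    by apply: fmem_check_branch_name; exists b => //; left.
  have [v vu vcmp] := cmp _ u (cond_le_trans us sr) ub _ (cond_le_refl u).
  have vt := cond_le_trans vu ut.
  have xav : feq le x (check P (vord a)) v by apply: feq_le xa.
  (* The disjunction nests to the right, so choosing between its last two cases takes a further
     extension [w]. *)
  case: vcmp => [xb|/(_ v (cond_le_refl v))[w wv]].
    by move: ab; rewrite (check_unique xav xb) Order.POrderTheory.ltxx.
  case=> /fmem_Rdot /(_ w (cond_le_refl w)) [z zw [a' [b' [ab' E1 E2]]]];
    have zv := cond_le_trans zw wv;
    have xaz : feq le x (check P (vord a)) z by apply: feq_le xav.
  + rewrite -(check_unique xaz E1) -(feq_check_inj E2) in ab'.
    have zs : le z s by apply: cond_le_trans us; apply: cond_le_trans vu.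
    exists z => //; apply: (fmem_eql (feq_sym xaz)); apply: fmem_check_branch_name.
    apply: (in_branch_down ab'); apply: (in_branch_le (cond_le_trans zv vu)).
    by exists b => //; left.
  + rewrite -(check_unique xaz E2) -(feq_check_inj E1) in ab'.
    by have := Order.POrderTheory.lt_trans ab (tlt_lt ab');
      rewrite Order.POrderTheory.ltxx.
- move=> x q qp /fmem_check_vord xw1.
  apply: (dense_below_bind xw1) => r rq [a aw1 xa] s sr.
  have [t ts [b bi ab]] := extend_branch s i aw1.
  exists t => //; exists (check P (vord b)); split.
    by apply: fmem_check_branch_name; exists b => //; left.
  apply: (fmem_eql (feq_sym (feq_le (cond_le_trans ts sr) xa))).
  exact: fmem_check_lt.
Qed.

(** * The name of the injection sending [i] to b_i *)

Definition enum_name : name P :=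
  Name (fun t : W * P => opair (check P (vord t.1)) (branch_name t.1))
    (fun t => t.2).

Lemma fmem_opair_enum_name (x y : name P) p : fmem le (opair x y) enum_name p <->
  dense_below le (fun r => exists2 i, feq le x (check P (vord i)) r
    & feq le y (branch_name i) r) p.
Proof.
split=> H; apply: (dense_below_impl H) => r rp.
  by case=> -[i q] /= _ /feq_opair_inj[]; exists i.
by case=> i xi yi; exists (i, r); [apply: cond_le_refl|apply: feq_opair].
Qed.

(** Functionality rests on distinct ordinals having check names never forced equal, injectivity on
    [branch_name_inj]. *)
Lemma finjection_enum_name p :
  finjection le enum_name (check P (vset_of [set: W]))
    (fbranch le (omega1_name pi Y Gamma) (Rdot pi Y Gamma)) p.
Proof.
split; [|split; [|split]].
- move=> z q qp zf; apply: (dense_below_impl zf) => r rq [[i s] /= rs zi].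
  exists (check P (vord i)); split.
    apply/fmem_check_vset; apply: dense_below_always => t _.
    by exists i => //; apply: feq_refl.
  apply: dense_below_always => t tr; exists (branch_name i).
  by split; [exact: fbranch_branch_name|apply: feq_le zi].
- move=> a q qp /fmem_check_vset H; apply: (dense_below_impl H) => r rq [i _ ai].
  exists (branch_name i); apply/fmem_opair_enum_name.
  apply: dense_below_always => s sr; exists i; first exact: feq_le ai.
  exact: feq_refl.
- move=> a b b' q qp /fmem_opair_enum_name ab r rq /fmem_opair_enum_name ab'.
  apply: feq_dense; apply: (dense_below_bind (dense_below_le rq ab)) => s sr [i ai bi].
  apply: (dense_below_impl (dense_below_le sr ab')) => t ts [i' ai' bi'].
  have ii' : i = i' by apply: check_unique ai'; apply: feq_le ai.
  subst i'.
  by apply: (feq_trans (feq_le ts bi)); apply: feq_sym.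
- move=> a a' b q qp /fmem_opair_enum_name ab r rq /fmem_opair_enum_name ab'.
  apply: feq_dense; apply: (dense_below_bind (dense_below_le rq ab)) => s sr [i ai bi].
  apply: (dense_below_impl (dense_below_le sr ab')) => t ts [i' ai' bi'].
  have ii' : i = i'.
    by apply: (@branch_name_inj _ _ t); apply: feq_trans bi'; apply: feq_sym; apply: feq_le bi.
  subst i'.
  by apply: (feq_trans (feq_le ts ai)); apply: feq_sym.
Qed.

End Extension.

Theorem lemma7p7 (d : Order.disp_t) (W : omega2Type d)
    (hcard : [set A : set W | A `<=` seg w1] #= [set: W])
    (pi : W -> zset) (hpi : bijection_HC pi)
    (Y : set (set W)) (hYstat : stationary_countable Y) (hYthin : thin Y)
    (hYseg : segment_closed Y)
    (Gamma : set W) (hGamma : Gamma `<=` Lambda pi Y)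
    (hGstat : stationary Gamma)
    (hpres : preserves_omega12 (@cond_le d W pi Y Gamma) W) :
  forced (fomega2_branches (@cond_le d W pi Y Gamma)
            (omega1_name pi Y Gamma) (Rdot pi Y Gamma)).
Proof.
move=> p; apply: dense_below_always => q _.
(* By preservation, the omega_2 of the ground model is the omega_2 of the extension. *)
exists (check _ (vset_of [set: W])); split; first exact: hpres.2.
apply: dense_below_always => r _; exists enum_name.
exact: finjection_enum_name.
Qed.
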